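(* Let $Q=Q_0+sQ_1$ with $Q_0,Q_1\in\mathbb{H}[t]$ and $Q_1$ monic, let $\gcd(Q)=1$, and suppose $QQ^\ast=PR$ with $P\in\mathbb{R}[t]$ and $R\in\mathbb{R}[s]$. Let $\#A$ and $\#B$ be the multiplicity cardinalities of $Q$, i.e. the numbers of complex zeros, counted with multiplicity, of $Q_1Q_0^\ast$ and of $Q_0^\ast Q_1$, respectively. Then the following statements are equivalent: (a) $|\mathrm{Fact}(Q)|>1$. (b) $\deg P<\#A+\#B$.
   Context: $\mathbb{H}$ is the skew field of real quaternions with units $\mathbf{i},\mathbf{j},\mathbf{k}$; $\mathbb{H}[t,s]$ is the ring of polynomials in which $t,s$ commute with each other and with all coefficients. $Q^\ast$ is obtained by conjugating all coefficients. $\gcd(Q)$ is the monic greatest common divisor in $\mathbb{R}[t,s]$ of the four real coordinate polynomials of $Q$ with respect to $1,\mathbf{i},\mathbf{j},\mathbf{k}$. $\mathbb{C}\mathbb{H}=\mathbb{C}\otimes_{\mathbb{R}}\mathbb{H}$ is the algebra of complex quaternions (complex scalars commute with $\mathbf{i},\mathbf{j},\mathbf{k}$). For $H\in\mathbb{H}[t]$ and $z\in\mathbb{C}$, $H(z)\in\mathbb{C}\mathbb{H}$ is obtained by substituting $t=z$. The multiplicity $\operatorname{mult}(H,z)$ of $z$ as a zero of $H$ is the integer $\mu$ such that $(t-z)^\mu$ divides $H$ in $\mathbb{C}\mathbb{H}[t]$ and $(t-z)^{\mu+1}$ does not. Let $$A=\{z\in\mathbb{C}: (Q_1Q_0^\ast)(z)=0\},\quad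 B=\{z\in\mathbb{C}:(Q_0^\ast Q_1)(z)=0\},$$ $$\#A=\sum_{z\in A}\operatorname{mult}(Q_1Q_0^\ast,z),\qquad \#B=\sum_{z\in B}\operatorname{mult}(Q_0^\ast Q_1,z).$$ $\mathrm{fact}(Q)$ is the set of all factorizations $Q=(t-h_1)\cdots(t-h_n)(s-h)(t-k_1)\cdots(t-k_m)$ with $n,m\ge0$ and $h_i,h,k_j\in\mathbb{H}$ (an element is the tuple of linear factors; empty products equal $1$). Two elements of $\mathrm{fact}(Q)$ with left $t$-factors $t-h_1,\dots,t-h_n$ and $t-\hat h_1,\dots,t-\hat h_l$ (the factors to the left of the $s$-factor) are equivalent if $\prod_{i=1}^{n}(t-h_i)(t-h_i)^\ast=\prod_{i=1}^{l}(t-\hat h_i)(t-\hat h_i)^\ast$. $\mathrm{Fact}(Q)$ is the set of equivalence classes. *)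

(* Defs.v *)
From HB Require Import structures.
From mathcomp Require Import all_boot all_order all_algebra.
From mathcomp Require Import mathcomp_extra boolp classical_sets functions.
From mathcomp Require Import cardinality fsbigop reals.
From mathcomp Require Import complex.
From mathcomp Require Import ring.

Set Implicit Arguments.
Unset Strict Implicit.
Unset Printing Implicit Defensive.

Import Order.TTheory GRing.Theory Num.Theory.
Local Open Scope classical_set_scope.
Local Open Scope ring_scope.

(** Hamilton quaternions [qre + qi i + qj j + qk k] over a commutative ring
    [K].  The real quaternions are [quat R]; the complex quaternions, i.e. the
    tensor product of C and H over R, are [quat R[i]]. *)
Record quat (K : Type) := Quat { qre : K; qi : K; qj : K; qk : K }.

Definition quat_map (K L : Type) (f : K -> L) (a : quat K) : quat L :=
  Quat (f (qre a)) (f (qi a)) (f (qj a)) (f (qk a)).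

Definition quat_to_prod (K : Type) (a : quat K) : K * K * K * K :=
  (qre a, qi a, qj a, qk a).

Definition quat_of_prod (K : Type) (p : K * K * K * K) : quat K :=
  let: (a, b, c, d) := p in Quat a b c d.

Lemma quat_to_prodK (K : Type) : cancel (@quat_to_prod K) (@quat_of_prod K).
Proof. by case. Qed.

HB.instance Definition _ (K : eqType) :=
  Equality.copy (quat K) (can_type (@quat_to_prodK K)).
HB.instance Definition _ (K : choiceType) :=
  Choice.copy (quat K) (can_type (@quat_to_prodK K)).

Section QuatZmodule.
Variable K : zmodType.

Definition quat_zero : quat K := Quat 0 0 0 0.

Definition quat_opp (a : quat K) : quat K :=
  Quat (- qre a) (- qi a) (- qj a) (- qk a).

Definition quat_add (a b : quat K) : quat K :=
  Quat (qre a + qre b) (qi a + qi b) (qj a + qj b) (qk a + qk b).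

Lemma quat_addA : associative quat_add.
Proof. by move=> a b c; rewrite /quat_add /= !addrA. Qed.

Lemma quat_addC : commutative quat_add.
Proof.
move=> a b; rewrite /quat_add.
by rewrite (addrC (qre a)) (addrC (qi a)) (addrC (qj a)) (addrC (qk a)).
Qed.

Lemma quat_add0 : left_id quat_zero quat_add.
Proof. by case=> a b c d; rewrite /quat_add /= !add0r. Qed.

Lemma quat_addN : left_inverse quat_zero quat_opp quat_add.
Proof. by move=> a; rewrite /quat_add /= !addNr. Qed.

End QuatZmodule.

HB.instance Definition _ (K : zmodType) :=
  GRing.isZmodule.Build (quat K)
    (@quat_addA K) (@quat_addC K) (@quat_add0 K) (@quat_addN K).

Section QuatRing.
Variable K : comNzRingType.

Definition quat_one : quat K := Quat 1 0 0 0.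

Definition quat_mul (a b : quat K) : quat K :=
  Quat
    (qre a * qre b - qi a * qi b - qj a * qj b - qk a * qk b)
    (qre a * qi b + qi a * qre b + qj a * qk b - qk a * qj b)
    (qre a * qj b - qi a * qk b + qj a * qre b + qk a * qi b)
    (qre a * qk b + qi a * qj b - qj a * qi b + qk a * qre b).

Lemma quat_mulA : associative quat_mul.
Proof. by move=> a b c; rewrite /quat_mul /=; congr Quat; ring. Qed.

Lemma quat_mul1q : left_id quat_one quat_mul.
Proof. by case=> a b c d; rewrite /quat_mul /=; congr Quat; ring. Qed.

Lemma quat_mulq1 : right_id quat_one quat_mul.
Proof. by case=> a b c d; rewrite /quat_mul /=; congr Quat; ring. Qed.

Lemma quat_mulDl : left_distributive quat_mul (@quat_add K).
Proof.
by move=> a b c; rewrite /quat_mul /quat_add /=; congr Quat; ring.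
Qed.

Lemma quat_mulDr : right_distributive quat_mul (@quat_add K).
Proof.
by move=> a b c; rewrite /quat_mul /quat_add /=; congr Quat; ring.
Qed.

Lemma quat_oner_neq0 : quat_one != 0.
Proof.
by apply/eqP => /(congr1 (@qre K)) /= /eqP; rewrite oner_eq0.
Qed.

End QuatRing.

HB.instance Definition _ (K : comNzRingType) :=
  GRing.Zmodule_isNzRing.Build (quat K)
    (@quat_mulA K) (@quat_mul1q K) (@quat_mulq1 K)
    (@quat_mulDl K) (@quat_mulDr K) (@quat_oner_neq0 K).

Definition qscalar (K : nmodType) (x : K) : quat K := Quat x 0 0 0.

Definition qconj (K : zmodType) (a : quat K) : quat K :=
  Quat (qre a) (- qi a) (- qj a) (- qk a).

(** Univariate polynomials are polynomials in [t].  In a bivariate polynomial,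
    of type [{poly {poly K}}], the outer variable is [s] and the inner one is
    [t]; over [quat R] both variables are central. *)

Definition pconj (R : realType) (H : {poly quat R}) : {poly quat R} :=
  map_poly (@qconj R) H.

Definition pconj2 (R : realType) (Q : {poly {poly quat R}}) :
    {poly {poly quat R}} :=
  map_poly (@pconj R) Q.

Definition real_t (R : realType) (P : {poly R}) : {poly {poly quat R}} :=
  (map_poly (@qscalar R) P)%:P.

Definition real_s (R : realType) (S : {poly R}) : {poly {poly quat R}} :=
  map_poly (fun x : R => (qscalar x)%:P) S.

(** Divisibility in an arbitrary ring.  The relation [%|] of [polydiv] is
    pseudo-divisibility, which is not divisibility over [{poly R}].  Below, the
    divisor is always central. *)
Definition divides (A : nzRingType) (d a : A) : Prop := exists c : A, a = c * d.

Definition coord2 (R : realType) (f : quat R -> R)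
    (Q : {poly {poly quat R}}) : {poly {poly R}} :=
  map_poly (map_poly f) Q.

Definition divides_coords (R : realType) (d : {poly {poly R}})
    (Q : {poly {poly quat R}}) : Prop :=
  [/\ divides d (coord2 (@qre R) Q), divides d (coord2 (@qi R) Q),
      divides d (coord2 (@qj R) Q) & divides d (coord2 (@qk R) Q)].

(** [g] is the gcd of the four coordinates of [Q], monic with respect to the
    lexicographic order with [t < s]. *)
Definition is_gcd (R : realType) (Q : {poly {poly quat R}})
    (g : {poly {poly R}}) : Prop :=
  [/\ lead_coef (lead_coef g) = 1,
      divides_coords g Q &
      forall d : {poly {poly R}}, divides_coords d Q -> divides d g].

Definition complexify (R : realType) (H : {poly quat R}) :
    {poly quat R[i]} :=
  map_poly (quat_map (real_complex R)) H.

Definition zeros (R : realType) (H : {poly quat R}) : set R[i] :=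
  [set z | (complexify H).[qscalar z] = 0].

(** For [H = 0] no such integer exists and the value is the junk value [0]. *)
Definition mult (R : realType) (H : {poly quat R}) (z : R[i]) : nat :=
  xget 0%N [set mu : nat |
    divides (('X - (qscalar z)%:P) ^+ mu) (complexify H) /\
    ~ divides (('X - (qscalar z)%:P) ^+ mu.+1) (complexify H)].

(** The sum is meaningful when [H] has finitely many zeros, i.e. [H <> 0]. *)
Definition card_zeros (R : realType) (H : {poly quat R}) : nat :=
  \sum_(z \in zeros H) mult H z.

(** A product (t-h_1)...(t-h_n)(s-h)(t-k_1)...(t-k_m), given by its linear
    factors. *)
Record factorization (R : realType) := Factorization {
  left_t : seq (quat R);
  mid_s : quat R;
  right_t : seq (quat R) }.

Definition prod_t (R : realType) (hs : seq (quat R)) : {poly quat R} :=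
  \prod_(h <- hs) ('X - h%:P).

Definition factorization_prod (R : realType) (f : factorization R) :
    {poly {poly quat R}} :=
  (prod_t (left_t f))%:P * ('X - (mid_s f)%:P%:P) * (prod_t (right_t f))%:P.

Definition fact (R : realType) (Q : {poly {poly quat R}}) :
    set (factorization R) :=
  [set f | Q = factorization_prod f].

Definition left_norm (R : realType) (f : factorization R) : {poly quat R} :=
  \prod_(h <- left_t f) (('X - h%:P) * pconj ('X - h%:P)).

Definition fact_class (R : realType) (Q : {poly {poly quat R}})
    (f : factorization R) : set (factorization R) :=
  [set g | fact Q g /\ left_norm g = left_norm f].

Definition Fact (R : realType) (Q : {poly {poly quat R}}) :
    set (set (factorization R)) :=
  [set fact_class Q f | f in fact Q].

(* Main.v *)
(** Write x = Q1, y = Q0 and N for the quaternion norm.  The hypothesis on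
    Q Q* says that N(y) = r0 N(x) and Re(x y* ) = r1 N(x) with real constants
    r0, r1.  At a complex zero z of N(x) the pencil y + s x therefore consists
    of null quaternions, and in C (x) H = M_2(C) this forces x(z) y(z)* = 0 or
    y(z)* x(z) = 0.  Since gcd(Q) = 1, z is not real, and the two cases yield a
    common right, respectively left, factor t - k of x and y.  Splitting off
    right factors as long as possible, and only then left ones, gives a
    factorization Q = F (s - h) G in which x y* = N(G) u and u has no complex
    zero, so deg N(G) = #A; the same for Q* gives one with deg N(F) = #B.
    Conversely every factorization has N(G) | x y* and N(F) | y* x, while
    N(F) N(G) = P up to a constant.  If deg P >= #A + #B then N(F) must be the
    gcd of the coordinates of y* x, hence there is at most one class; otherwise
    the two extreme factorizations are inequivalent. *)

Require Import Defs.
From HB Require Import structures.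
From mathcomp Require Import all_boot all_order all_algebra.
From mathcomp Require Import mathcomp_extra boolp classical_sets functions.
From mathcomp Require Import cardinality fsbigop reals.
From mathcomp Require Import complex.
From mathcomp Require Import ring zify.

Set Implicit Arguments.
Unset Strict Implicit.
Unset Printing Implicit Defensive.

Import Order.TTheory GRing.Theory Num.Theory.
Local Open Scope classical_set_scope.
Local Open Scope ring_scope.

(** * Quaternions over a commutative ring: conjugation, norm, base change *)

Section QuatTheory.
Variable K : comNzRingType.
Implicit Types (x y : quat K) (a : K).

Lemma quatP x y :
  qre x = qre y -> qi x = qi y -> qj x = qj y -> qk x = qk y -> x = y.
Proof. by case: x y => [a b c d] [a' b' c' d'] /= -> -> -> ->. Qed.

Definition qnorm x : K := qre x ^+ 2 + qi x ^+ 2 + qj x ^+ 2 + qk x ^+ 2.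

Lemma qconjK : involutive (@qconj K).
Proof. by move=> x; apply: quatP => /=; ring. Qed.

Lemma qconjM x y : qconj (x * y) = qconj y * qconj x.
Proof. by apply: quatP => /=; ring. Qed.

Lemma mulq_conj x : x * qconj x = qscalar (qnorm x).
Proof. by apply: quatP; rewrite /qnorm /=; ring. Qed.

Lemma mul_conjq x : qconj x * x = qscalar (qnorm x).
Proof. by apply: quatP; rewrite /qnorm /=; ring. Qed.

Lemma qnormM x y : qnorm (x * y) = qnorm x * qnorm y.
Proof. by rewrite /qnorm /=; ring. Qed.

Lemma qnorm1 : qnorm 1 = 1.
Proof. by rewrite /qnorm /=; ring. Qed.

Lemma qnorm_conj x : qnorm (qconj x) = qnorm x.
Proof. by rewrite /qnorm /=; ring. Qed.

Lemma qscalarC a x : qscalar a * x = x * qscalar a.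
Proof. by apply: quatP => /=; ring. Qed.

Lemma qconj_scalar a : qconj (qscalar a) = qscalar a.
Proof. by apply: quatP => /=; ring. Qed.

Lemma qconj_is_additive : zmod_morphism (@qconj K).
Proof. by move=> x y; apply: quatP => /=; ring. Qed.
HB.instance Definition _ :=
  GRing.isZmodMorphism.Build (quat K) (quat K) (@qconj K) qconj_is_additive.

Lemma qscalar_is_additive : zmod_morphism (@qscalar K).
Proof. by move=> a b; apply: quatP => /=; ring. Qed.
HB.instance Definition _ :=
  GRing.isZmodMorphism.Build K (quat K) (@qscalar K) qscalar_is_additive.

Lemma qscalar_is_multiplicative : monoid_morphism (@qscalar K).
Proof. by split=> // a b; apply: quatP => /=; ring. Qed.
HB.instance Definition _ := GRing.isMonoidMorphism.Build K (quat K)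
  (@qscalar K) qscalar_is_multiplicative.

Lemma qre_is_additive : zmod_morphism (@qre K). Proof. by []. Qed.
Lemma qi_is_additive : zmod_morphism (@qi K). Proof. by []. Qed.
Lemma qj_is_additive : zmod_morphism (@qj K). Proof. by []. Qed.
Lemma qk_is_additive : zmod_morphism (@qk K). Proof. by []. Qed.
HB.instance Definition _ :=
  GRing.isZmodMorphism.Build (quat K) K (@qre K) qre_is_additive.
HB.instance Definition _ :=
  GRing.isZmodMorphism.Build (quat K) K (@qi K) qi_is_additive.
HB.instance Definition _ :=
  GRing.isZmodMorphism.Build (quat K) K (@qj K) qj_is_additive.
HB.instance Definition _ :=
  GRing.isZmodMorphism.Build (quat K) K (@qk K) qk_is_additive.

End QuatTheory.

Section QuatMap.
Variables (K L : comNzRingType) (f : {rmorphism K -> L}).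

Lemma quat_map_is_additive : zmod_morphism (quat_map f).
Proof. by move=> x y; apply: quatP; rewrite /= rmorphB. Qed.
HB.instance Definition _ := GRing.isZmodMorphism.Build (quat K) (quat L)
  (quat_map f) quat_map_is_additive.

Lemma quat_map_is_multiplicative : monoid_morphism (quat_map f).
Proof.
split; first by rewrite /quat_map /= rmorph1 rmorph0.
by move=> x y; apply: quatP => /=; rewrite !(rmorphD, rmorphN, rmorphM).
Qed.
HB.instance Definition _ := GRing.isMonoidMorphism.Build (quat K) (quat L)
  (quat_map f) quat_map_is_multiplicative.

Lemma quat_map_scalar a : quat_map f (qscalar a) = qscalar (f a).
Proof. by rewrite /quat_map /qscalar /= rmorph0. Qed.

Lemma quat_map_conj x : quat_map f (qconj x) = qconj (quat_map f x).
Proof. by rewrite /quat_map /qconj /= !rmorphN. Qed.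

Lemma qnorm_map x : qnorm (quat_map f x) = f (qnorm x).
Proof. by rewrite /qnorm /= !rmorphD !rmorphXn. Qed.

End QuatMap.

(** * Quaternionic polynomials as quaternions over a commutative polynomial ring *)

Section PolyCoordinates.
Variable K : comNzRingType.
Implicit Types (H G : {poly quat K}) (x : quat {poly K}).

(** As the variable is central, this is a ring isomorphism; it turns identities of noncommutative
    polynomials into coordinate identities within reach of [ring]. *)
Definition quat_of_poly H : quat {poly K} :=
  Quat (map_poly (@qre K) H) (map_poly (@qi K) H)
       (map_poly (@qj K) H) (map_poly (@qk K) H).

Definition poly_of_quat x : {poly quat K} :=
  \poly_(i < maxn (maxn (size (qre x)) (size (qi x)))
                  (maxn (size (qj x)) (size (qk x))))
     quat_map (coefp i) x.

Lemma quat_of_polyK : cancel quat_of_poly poly_of_quat.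
Proof.
move=> H; apply/polyP=> i; rewrite coef_poly; case: ltnP => [_|le_i].
  by apply: quatP; rewrite /= coef_map.
move: le_i; rewrite !geq_max => /andP[/andP[h1 h2] /andP[h3 h4]].
apply/esym/quatP => /=.
- by move/leq_sizeP/(_ _ (leqnn i)): h1; rewrite coef_map.
- by move/leq_sizeP/(_ _ (leqnn i)): h2; rewrite coef_map.
- by move/leq_sizeP/(_ _ (leqnn i)): h3; rewrite coef_map.
- by move/leq_sizeP/(_ _ (leqnn i)): h4; rewrite coef_map.
Qed.

Lemma poly_of_quatK : cancel poly_of_quat quat_of_poly.
Proof.
move=> x; apply: quatP; apply/polyP=> i; rewrite coef_map coef_poly;
  case: ltnP => //=; rewrite !geq_max => /andP[/andP[h1 h2] /andP[h3 h4]];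
  by rewrite nth_default.
Qed.

Lemma quat_of_poly_is_additive : zmod_morphism quat_of_poly.
Proof. by move=> H G; apply: quatP; rewrite /= raddfB. Qed.
HB.instance Definition _ := GRing.isZmodMorphism.Build
  {poly quat K} (quat {poly K}) quat_of_poly quat_of_poly_is_additive.

Lemma quat_of_poly_is_multiplicative : monoid_morphism quat_of_poly.
Proof.
split.
  by apply: quatP; rewrite /= -[1]/(1%:P) map_polyC.
move=> H G; apply: quatP; apply/polyP=> i;
  rewrite /= !(coefD, coefN, coef_map) !coefM;
  rewrite raddf_sum /= -?sumrN -?big_split /=;
  by apply: eq_bigr => j _; rewrite !coef_map /=; ring.
Qed.
HB.instance Definition _ := GRing.isMonoidMorphism.Build
  {poly quat K} (quat {poly K}) quat_of_poly quat_of_poly_is_multiplicative.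

Lemma quat_of_polyC (a : quat K) :
  quat_of_poly a%:P = quat_map (@polyC K) a.
Proof. by apply: quatP; rewrite /= map_polyC. Qed.

Lemma quat_of_polyX : quat_of_poly 'X = qscalar 'X.
Proof.
by apply: quatP; apply/polyP=> i; rewrite /= !(coef_map, coefX, coef0);
  case: (i == 1%N).
Qed.

Lemma quat_of_poly_scalar (p : {poly K}) :
  quat_of_poly (map_poly (@qscalar K) p) = qscalar p.
Proof.
by apply: quatP; apply/polyP=> i; rewrite /= !(coef_map, coef0).
Qed.

Lemma horner_qscalar H (z : K) :
  quat_map (horner_eval z) (quat_of_poly H) = H.[qscalar z].
Proof.
elim/poly_ind: H => [|H c IH]; first by rewrite !rmorph0 horner0.
rewrite hornerMXaddC -IH rmorphD rmorphM /= rmorphD rmorphM /=.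
congr (_ * _ + _).
  by rewrite quat_of_polyX quat_map_scalar /= /horner_eval hornerX.
by rewrite quat_of_polyC; apply: quatP; rewrite /= /horner_eval hornerC.
Qed.

End PolyCoordinates.

(** * Contents and the counting of complex zeros *)

Section Content.
Variable F : fieldType.
Implicit Types (p d : {poly F}) (x y : quat {poly F}).

Definition content x : {poly F} :=
  gcdp (gcdp (qre x) (qi x)) (gcdp (qj x) (qk x)).

Lemma dvdp_content d x : d %| content x ->
  exists y, x = qscalar d * y.
Proof.
rewrite !dvdp_gcd => /andP[/andP[/dvdpP[a xa] /dvdpP[b xb]]].
move=> /andP[/dvdpP[e xe] /dvdpP[f xf]].
by exists (Quat a b e f); apply: quatP; rewrite /= ?xa ?xb ?xe ?xf; ring.
Qed.

Lemma content_scalarM d y : content (qscalar d * y) %= d * content y.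
Proof.
have -> : qscalar d * y = Quat (d * qre y) (d * qi y) (d * qj y) (d * qk y).
  by apply: quatP => /=; ring.
rewrite /content /= (eqp_trans (eqp_gcd (gcdp_mul2l _ _ _) (gcdp_mul2l _ _ _)))//.
exact: gcdp_mul2l.
Qed.

Lemma content_eq0 x : (content x == 0) = (x == 0).
Proof.
apply/idP/eqP => [|->]; last by rewrite /content !gcdp0.
rewrite -dvd0p => /dvdp_content[y ->].
by rewrite rmorph0 mul0r.
Qed.

(** A central divisor divides the four coordinates separately. This reduces the divisibility in
    [mult] to root multiplicities of one commutative polynomial. *)
Lemma divides_content d (G : {poly quat F}) :
  divides (map_poly (@qscalar F) d) G <-> d %| content (quat_of_poly G).
Proof.
split=> [[c ->]|/dvdp_content[y Gy]].
  rewrite rmorphM /= quat_of_poly_scalar -qscalarC.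
  by rewrite (eqp_dvdr _ (content_scalarM _ _)) dvdp_mulIl.
exists (poly_of_quat y); apply: (can_inj (@quat_of_polyK F)).
by rewrite Gy rmorphM /= quat_of_poly_scalar poly_of_quatK qscalarC.
Qed.

End Content.

(** Gcds are preserved by field extension, so the content of a complexified polynomial is still
    real. *)
Lemma content_map (E F : fieldType) (f : {rmorphism E -> F})
    (x : quat {poly E}) :
  content (quat_map (map_poly f) x) = map_poly f (content x).
Proof. by rewrite /content /= !gcdp_map. Qed.

(** The polynomial splits into linear factors, and the multiplicity of [z] is the number of its
    occurrences in the list of roots. *)
Lemma sum_mup_roots (F : closedFieldType) (g : {poly F}) (rs : seq F) :
  g != 0 -> uniq rs -> (forall z, (z \in rs) = root g z) ->
  (\sum_(z <- rs) mup z g)%N = (size g).-1.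
Proof.
move=> g0 urs rsP; have [s gs] := closed_field_poly_normal g.
have lg0 : lead_coef g != 0 by rewrite lead_coef_eq0.
have mupg z : mup z g = count_mem z s.
  rewrite gs -mul_polyC mupMr ?rootC //.
  elim: s {gs} => [|a s IH]; first by rewrite big_nil mupNroot // root1.
  rewrite big_cons mupM ?polyXsubC_eq0 ?monic_neq0 ?monic_prod_XsubC //.
  by rewrite -['X - _]expr1 mup_XsubCX IH /= eq_sym; case: eqP.
have -> : (size g).-1 = size s.
  by rewrite gs size_scale // size_prod_XsubC.
have ps : perm_eq rs (undup s).
  apply: uniq_perm => //; first exact: undup_uniq.
  move=> z; rewrite mem_undup rsP gs rootZ // root_prod_XsubC //.
rewrite (perm_big _ ps) /= -(perm_size (perm_count_undup s)) size_flatten.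
rewrite sumnE /shape !big_map.
by apply: eq_bigr => z _; rewrite size_nseq mupg.
Qed.

Section CardZeros.
Variable R : realType.
Local Notation toC := (real_complex R).
Implicit Types (H : {poly quat R}) (x y : quat {poly R}).

Definition ceval (z : R[i]) (p : {poly R}) : R[i] := (map_poly toC p).[z].

Lemma ceval_is_additive z : zmod_morphism (ceval z).
Proof. by move=> p q; rewrite /ceval rmorphB hornerD hornerN. Qed.
HB.instance Definition _ z := GRing.isZmodMorphism.Build
  {poly R} R[i] (ceval z) (ceval_is_additive z).

Lemma ceval_is_multiplicative z : monoid_morphism (ceval z).
Proof.
by split=> [|p q]; rewrite /ceval ?rmorph1 ?hornerC// rmorphM hornerM.
Qed.
HB.instance Definition _ z := GRing.isMonoidMorphism.Build
  {poly R} R[i] (ceval z) (ceval_is_multiplicative z).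

Lemma quat_of_complexify H :
  quat_of_poly (complexify H) = quat_map (map_poly toC) (quat_of_poly H).
Proof.
by apply: quatP; apply/polyP=> i; rewrite /= !coef_map.
Qed.

Lemma horner_complexify H z :
  (complexify H).[qscalar z] = quat_map (ceval z) (quat_of_poly H).
Proof. by rewrite -horner_qscalar quat_of_complexify. Qed.

Lemma ceval_eq0P z x :
  quat_map (ceval z) x = 0 <-> root (map_poly toC (content x)) z.
Proof.
rewrite -content_map /content /= !root_gcd.
split=> [/(congr1 (@quat_to_prod _))[a b c d]|].
  by rewrite /root; move: a b c d; rewrite /ceval => -> -> -> ->; rewrite eqxx.
case/andP=> /andP[/rootP a /rootP b] /andP[/rootP c /rootP d].
by apply: quatP.
Qed.

Lemma mult_mup H z : H != 0 ->
  mult H z = mup z (map_poly toC (content (quat_of_poly H))).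
Proof.
move=> H0; set g := map_poly _ _.
have g0 : g != 0.
  rewrite map_poly_eq0 content_eq0 -(rmorph0 (@quat_of_poly R)).
  by rewrite (inj_eq (can_inj (@quat_of_polyK R))).
have divE mu : divides (('X - (qscalar z)%:P) ^+ mu) (complexify H) <->
    (mu <= mup z g)%N.
  rewrite mup_geq // /g -content_map -quat_of_complexify -divides_content.
  by rewrite rmorphXn rmorphB /= map_polyX map_polyC.
(* By [divE], [mup z g] is the only element of the set, so [xget] never returns its default
   value. *)
rewrite /mult; case: xgetP => [m -> [/divE h1 /divE h2]|/(_ (mup z g))[]].
  by apply/eqP; rewrite eqn_leq h1 leqNgt; apply/negP.
by split; [apply/divE|move/divE; rewrite ltnn].
Qed.

(** The zeros of [H] are the roots of its content, with the same multiplicities; hence [#A] and [#B]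
    are degrees of contents. *)
Lemma card_zerosE H : H != 0 ->
  card_zeros H = (size (content (quat_of_poly H))).-1.
Proof.
move=> H0; set g := content _.
have g0 : g != 0.
  rewrite content_eq0 -(rmorph0 (@quat_of_poly R)).
  by rewrite (inj_eq (can_inj (@quat_of_polyK R))).
have G0 : map_poly toC g != 0 by rewrite map_poly_eq0.
have [s gs] := closed_field_poly_normal (map_poly toC g).
have rsP z : (z \in undup s) = root (map_poly toC g) z.
  by rewrite mem_undup gs rootZ ?lead_coef_eq0 // root_prod_XsubC.
have zs : zeros H = [set` undup s].
  apply/seteqP; split=> z; rewrite /zeros /= rsP horner_complexify.
    by move/ceval_eq0P.
  by move=> h; apply/ceval_eq0P.
rewrite /card_zeros zs -fsbig_seq ?undup_uniq //.
rewrite -(size_map_poly toC) -(sum_mup_roots G0 (undup_uniq s) rsP).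
by apply: eq_bigr => z _; rewrite mult_mup.
Qed.

(** Without complex zeros of [x], the content of [x] has no root and is a nonzero constant. *)
Lemma size_content_scalarM (p : {poly R}) x :
  (forall z, quat_map (ceval z) x <> 0) ->
  size (content (qscalar p * x)) = size p.
Proof.
move=> nz; rewrite (eqp_size (content_scalarM _ _)).
have [-> | p0] := eqVneq p 0; first by rewrite mul0r.
suff /eqP s1 : size (content x) == 1%N.
  have c0 : content x != 0 by rewrite -size_poly_eq0 s1.
  by rewrite size_mul // s1 addn1.
rewrite -(size_map_poly toC).
by apply/closed_rootP => -[z /ceval_eq0P]; exact: nz.
Qed.

End CardZeros.

(** * Null quaternions and zero products *)

Section NullQuaternions.
Variable K : comNzRingType.
Implicit Types x y l : quat K.

Lemma addq_conj x : x + qconj x = qscalar (qre x *+ 2).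
Proof. by apply: quatP => /=; ring. Qed.

Lemma qconjD x y : qconj (x + y) = qconj x + qconj y.
Proof. exact: raddfD. Qed.

Lemma mulq_conj_mulr l x y :
  (x * l) * qconj (y * l) = qscalar (qnorm l) * (x * qconj y).
Proof. by rewrite qconjM mulrA -[x * l * _]mulrA mulq_conj -qscalarC -mulrA. Qed.

Lemma inner_mull l x y :
  qre ((l * x) * qconj (l * y)) = qnorm l * qre (x * qconj y).
Proof. by rewrite /qnorm /=; ring. Qed.

Lemma inner_mulr l x y :
  qre ((x * l) * qconj (y * l)) = qnorm l * qre (x * qconj y).
Proof. by rewrite /qnorm /=; ring. Qed.

Lemma inner_conj x y : qre (qconj x * qconj (qconj y)) = qre (x * qconj y).
Proof. by rewrite /=; ring. Qed.

(** Summing [e * w * qconj e] over the units 1, i, j, k gives [4 Re w]; here [w = t * x], and [y] is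
    multiplied on the right. *)
Lemma quat_average x y t :
  t * (x * qconj 1 * y) + Quat 0 1 0 0 * t * (x * qconj (Quat 0 1 0 0) * y)
  + Quat 0 0 1 0 * t * (x * qconj (Quat 0 0 1 0) * y)
  + Quat 0 0 0 1 * t * (x * qconj (Quat 0 0 0 1) * y)
  = qscalar (qre (t * x) *+ 4) * y.
Proof. by apply: quatP => /=; ring. Qed.

End NullQuaternions.

Lemma qscalar_mulE (K : comNzRingType) (a : K) (x : quat K) :
  qscalar a * x = Quat (a * qre x) (a * qi x) (a * qj x) (a * qk x).
Proof. by apply: quatP => /=; ring. Qed.

Lemma qscalar_mulI (K : idomainType) (a : K) (x y : quat K) :
  a != 0 -> qscalar a * x = qscalar a * y -> x = y.
Proof.
by move=> a0; rewrite !qscalar_mulE => -[] *; apply: quatP; apply: (mulfI a0).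
Qed.

(** The zero ideal is prime, as for 2x2 matrices. If [y] is nonzero, averaging forces
    [Re (t * x) = 0] for all [t], and four choices of [t] read off the coordinates of [x]. *)
Lemma quat_prime (K : numFieldType) (x y : quat K) :
  (forall z, x * z * y = 0) -> x = 0 \/ y = 0.
Proof.
move=> xy0; have [->|y0] := eqVneq y 0; [by right|left].
have tx t : qre (t * x) = 0.
  apply/eqP; move/eqP: y0; apply: contra_notT => tx0.
  apply: (@qscalar_mulI _ (qre (t * x) *+ 4)).
    by rewrite mulrn_eq0.
  by rewrite -quat_average !xy0 !mulr0 !addr0.
apply: quatP.
- by have := tx 1; rewrite mul1r.
- by have := tx (Quat 0 (-1) 0 0) => /= <-; ring.
- by have := tx (Quat 0 0 (-1) 0) => /= <-; ring.
- by have := tx (Quat 0 0 0 (-1)) => /= <-; ring.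
Qed.

(* In terms of 2x2 matrices: a pencil of matrices of rank at most one has a
   common kernel or a common image. *)
Lemma null_pencil (K : numFieldType) (x y : quat K) :
  qnorm x = 0 -> qnorm y = 0 -> qre (x * qconj y) = 0 ->
  x * qconj y = 0 \/ qconj y * x = 0.
Proof.
move=> nx ny xy0; apply: quat_prime => z.
(* [Re (x * qconj y) = 0] means [x * qconj y = - y * qconj x]; a further factor [x] on the right
   produces [N(x) = 0]. *)
have xyx : x * qconj y * x = 0.
  have := addq_conj (x * qconj y); rewrite xy0 mul0rn rmorph0.
  move/(canRL (addrK _)) ->; rewrite sub0r qconjM qconjK mulNr -mulrA.
  by rewrite mul_conjq nx rmorph0 mulr0 oppr0.
(* Since [N(y) = 0], [z] between two copies of [qconj y] gives a scalar multiple of [qconj y], which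
   reduces the product required by [quat_prime] to [xyx]. *)
have yzy : qconj y * z * qconj y = qscalar (qre (z * qconj y) *+ 2) * qconj y.
  rewrite qscalarC -addq_conj mulrDr qconjM qconjK.
  by rewrite !mulrA mul_conjq ny rmorph0 mul0r addr0.
have -> : x * qconj y * z * (qconj y * x) = x * (qconj y * z * qconj y) * x.
  by rewrite !mulrA.
by rewrite yzy mulrA -qscalarC -!mulrA [x * _]mulrA xyx mulr0.
Qed.

Lemma qnorm_eq0 (F : realDomainType) (x : quat F) : (qnorm x == 0) = (x == 0).
Proof.
apply/idP/eqP => [|->]; last by rewrite /qnorm /= expr0n /= !addr0.
rewrite /qnorm !paddr_eq0 ?addr_ge0 ?sqr_ge0 // !sqrf_eq0.
by case/andP=> /andP[/andP[/eqP ? /eqP ?] /eqP ?] /eqP ?; apply: quatP.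
Qed.

(** * Linear right factors at nonreal zeros of the norm *)

Section RightFactor.
Variable R : realType.
Local Notation toC := (real_complex R).
Local Notation "x @ z" := (quat_map (ceval z) x) (at level 10).
Local Notation const := (quat_map (@polyC R)).
Implicit Types (x y : quat {poly R}) (z : R[i]) (k : quat R).

Lemma quat_of_pconj (H : {poly quat R}) :
  quat_of_poly (pconj H) = qconj (quat_of_poly H).
Proof.
by apply: quatP; apply/polyP=> i; rewrite /= !(coefN, coef_map).
Qed.

(** For nonzero [x] the leading coefficient of [x * qconj x] is the norm of that of [x], a nonzero
    sum of real squares; so the norm has twice the degree of [x]. *)
Lemma qnorm_size_le1 x : (size (qnorm x) <= 1)%N -> exists c, x = const c.
Proof.
move=> n1; pose H := poly_of_quat x.
have [H0|H0] := eqVneq H 0.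
  exists 0; rewrite rmorph0 -[x](@poly_of_quatK R).
  by rewrite -/H H0 rmorph0.
have HH : H * pconj H = map_poly (@qscalar R) (qnorm x).
  apply: (can_inj (@quat_of_polyK R)); rewrite rmorphM /= quat_of_pconj.
  by rewrite poly_of_quatK mulq_conj quat_of_poly_scalar.
have sH : size (pconj H) = size H.
  by rewrite size_map_inj_poly ?raddf0 //; exact: (inv_inj (@qconjK R)).
have lH : lead_coef (pconj H) = qconj (lead_coef H).
  by rewrite /lead_coef sH coef_map.
have : size (H * pconj H) = (size H + size H).-1.
  rewrite size_proper_mul ?sH // lH mulq_conj.
  apply: contraNneq H0 => /(congr1 (@qre R)) /= /eqP.
  by rewrite qnorm_eq0 lead_coef_eq0.
rewrite HH size_map_inj_poly ?raddf0 //; last by move=> a b [].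
move=> sn; exists (H`_0); rewrite -quat_of_polyC -size1_polyC ?poly_of_quatK //.
by move: n1; rewrite sn; case: (size H) => // n; rewrite addSn addnS; lia.
Qed.

Lemma qnorm_poly_eq0 x : (qnorm x == 0) = (x == 0).
Proof.
apply/eqP/eqP => [n0|->]; last by rewrite /qnorm /= expr0n /= !addr0.
have [|c xc] := @qnorm_size_le1 x; first by rewrite n0 size_poly0.
move: n0; rewrite xc qnorm_map => /eqP; rewrite polyC_eq0 qnorm_eq0.
by move/eqP->; rewrite rmorph0.
Qed.

Lemma cevalC z (c : R) : ceval z c%:P = toC c.
Proof. by rewrite /ceval map_polyC hornerC. Qed.

(** The imaginary part of [p1 * z + p0 = 0] gives [p1 = 0], and then [p0 = 0]. *)
Lemma ceval_size2 z (p : {poly R}) :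
  complex.Im z != 0 -> (size p <= 2)%N -> ceval z p = 0 -> p = 0.
Proof.
move=> z0 sp.
have -> : p = (p`_1)%:P * 'X + (p`_0)%:P.
  apply/polyP=> -[|[|i]]; rewrite coefD coefMX coefC /= ?coefC ?add0r ?addr0 //.
  by rewrite nth_default // (leq_trans sp).
rewrite /ceval rmorphD rmorphM /= !map_polyC map_polyX hornerMXaddC hornerC /=.
case: z z0 => a b /= b0 [e1 e2].
have p1 : p`_1 = 0.
  by move: e2 => /eqP; rewrite mul0r !addr0 mulf_eq0 (negbTE b0) orbF => /eqP.
by move: e1; rewrite p1 !mul0r subr0 add0r => ->; rewrite ?polyC0 ?mul0r ?addr0.
Qed.

(** At a real point the norm is a sum of four real squares. *)
Lemma ceval_real_null z x :
  complex.Im z = 0 -> ceval z (qnorm x) = 0 -> x @ z = 0.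
Proof.
case: z => a b /= ->; rewrite -[Complex a 0]/(toC a) => n0.
have cE p : ceval (toC a) p = toC p.[a] by rewrite /ceval horner_map.
have x0 : quat_map (horner_eval a) x = 0.
  apply/eqP; rewrite -qnorm_eq0 qnorm_map; move: n0; rewrite cE.
  by move/eqP; rewrite fmorph_eq0.
have [] := congr1 (@quat_to_prod _) x0; rewrite /horner_eval => h1 h2 h3 h4.
by apply: quatP; rewrite /= cE ?h1 ?h2 ?h3 ?h4.
Qed.

Lemma size_affine (a b : R) : (size (a%:P * 'X + b%:P)%R <= 2)%N.
Proof. by rewrite size_MXaddC; case: ifP; rewrite // ltnS size_polyC leq_b1. Qed.

Definition qlin k : quat {poly R} := qscalar 'X - const k.

Lemma qnorm_qlin k :
  qnorm (qlin k) = 'X^2 - (qre k *+ 2)%:P * 'X + (qnorm k)%:P.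
Proof. by rewrite /qnorm /qlin /= !polyCD !polyCM; ring. Qed.

Lemma size_qnorm_qlin k : size (qnorm (qlin k)) = 3%N.
Proof.
by rewrite qnorm_qlin -addrA -mulNr -polyCN size_polyDl size_polyXn // ltnS
           size_affine.
Qed.

(** The remainder modulo the real quadratic [N(t - k)] has degree at most one and vanishes at the
    nonreal [z]. *)
Lemma dvdp_qnorm_qlin z k (p : {poly R}) :
  complex.Im z != 0 -> ceval z (qnorm (qlin k)) = 0 -> ceval z p = 0 ->
  qnorm (qlin k) %| p.
Proof.
move=> z0 nk pz; apply/eqP/(@ceval_size2 z) => //.
  by rewrite -ltnS -(size_qnorm_qlin k) ltn_modp -size_poly_eq0 size_qnorm_qlin.
move: pz; rewrite [in X in X -> _](divp_eq p (qnorm (qlin k))).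
by rewrite rmorphD rmorphM /= nk mulr0 add0r.
Qed.

Lemma dvd_qscalar_ceval z k x :
  complex.Im z != 0 -> ceval z (qnorm (qlin k)) = 0 -> x @ z = 0 ->
  exists y, x = qscalar (qnorm (qlin k)) * y.
Proof.
move=> z0 nk [x1 x2 x3 x4]; apply: dvdp_content; rewrite !dvdp_gcd.
by rewrite !(dvdp_qnorm_qlin z0 nk).
Qed.

(** Division by the real quadratic [M] with root [z] leaves a remainder [a t + b] that agrees with
    [y] at [z]. Being null but nonzero there, it has [a] invertible, so it equals [a (t - k)], and
    [N(t - k)] divides [M]. *)
Lemma right_linear_factor z y :
  complex.Im z != 0 -> ceval z (qnorm y) = 0 -> y @ z <> 0 ->
  exists k a w, [/\ a <> 0, ceval z (qnorm (qlin k)) = 0 &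
    y = (w * qconj (qlin k) + const a) * qlin k].
Proof.
move=> z0 ny yz.
(* [M] is the product of [t - z] and [t - conj z]. *)
pose M : {poly R} :=
  'X^2 + ((- (complex.Re z *+ 2))%:P * 'X
          + (complex.Re z ^+ 2 + complex.Im z ^+ 2)%:P).
have sM : size M = 3%N.
  by rewrite size_polyDl size_polyXn // ltnS size_affine.
have Mz : ceval z M = 0.
  rewrite /ceval /M 2!rmorphD /= map_polyXn [map_poly _ (_ * 'X)]rmorphM /=.
  rewrite !map_polyC map_polyX hornerD hornerXn hornerMXaddC hornerC /=.
  case: (z) => a b; apply/eqP; rewrite eq_complex /=.
  by apply/andP; split; apply/eqP; ring.
pose A := Quat (qre y %/ M) (qi y %/ M) (qj y %/ M) (qk y %/ M).
pose r := Quat (qre y %% M) (qi y %% M) (qj y %% M) (qk y %% M).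
have yE : y = qscalar M * A + r.
  by apply: quatP; rewrite /= [LHS](divp_eq _ M); ring.
pose a := quat_map (coefp 1) r; pose b := quat_map (coefp 0) r.
have rE : r = qscalar 'X * const a + const b.
  have lin p : p %% M = 'X * ((p %% M)`_1)%:P + ((p %% M)`_0)%:P.
    have := ltn_modp p M; rewrite -size_poly_eq0 sM => sp.
    apply/polyP=> -[|[|i]]; rewrite coefD coefXM coefC /= ?coefC ?add0r ?addr0 //.
    by rewrite nth_default // -ltnS (leq_trans sp).
  by apply: quatP; rewrite /= [LHS]lin; ring.
have rz : r @ z = y @ z.
  by rewrite yE rmorphD rmorphM /= quat_map_scalar /= Mz rmorph0 mul0r add0r.
have nr : ceval z (qnorm r) = 0 by rewrite -qnorm_map rz qnorm_map.
have a0 : qnorm a != 0.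
  rewrite qnorm_eq0; apply/eqP => a0; apply: yz.
  move: nr; rewrite -rz rE a0 rmorph0 mulr0 add0r qnorm_map.
  rewrite cevalC => /eqP; rewrite fmorph_eq0 qnorm_eq0 => /eqP b0.
  by rewrite b0 !rmorph0.
(* [k = - a^-1 b], with [qconj a / N(a)] as the inverse of [a]. *)
pose k := - (qscalar (qnorm a)^-1 * qconj a * b).
have rL : r = const a * qlin k.
  rewrite /qlin mulrBr -qscalarC rE -rmorphM /k mulrN rmorphN opprK /=.
  congr (_ + const _).
  by rewrite !mulrA -qscalarC -[_ * a * _]mulrA mulq_conj -rmorphM mulVf ?mul1r.
have nk : ceval z (qnorm (qlin k)) = 0.
  move: nr; rewrite rL qnormM rmorphM /= qnorm_map => /eqP.
  rewrite mulf_eq0 => /orP[|/eqP //].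
  by rewrite cevalC fmorph_eq0 (negbTE a0).
have /dvdpP[q Mq] := dvdp_qnorm_qlin z0 nk Mz.
exists k, a, (qscalar q * A); split=> //.
  by move=> a0'; move: a0; rewrite a0' qnorm_eq0 eqxx.
rewrite mulrDl -rL -mulrA mul_conjq -qscalarC mulrA -rmorphM mulrC -Mq.
by rewrite yE Mq.
Qed.

Lemma common_right_factor z x y :
  complex.Im z != 0 -> ceval z (qnorm y) = 0 -> y @ z <> 0 ->
  (x * qconj y) @ z = 0 ->
  exists k x' y', x = x' * qlin k /\ y = y' * qlin k.
Proof.
move=> z0 ny yz xy.
have [k [a [w [a0 nk yE]]]] := right_linear_factor z0 ny yz.
(* In [x * qconj y] at [z] the term with [w] contains [N(t - k)], which vanishes there. What remains
   is [x * qconj (t - k) * qconj a], and a factor [a] on the right turns [qconj a] into the nonzero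
   scalar [N(a)]. *)
have xk : (x * qconj (qlin k)) @ z = 0.
  have na : toC (qnorm a) != 0.
    by rewrite fmorph_eq0 qnorm_eq0; apply/eqP.
  apply: (qscalar_mulI na); rewrite mulr0.
  have caz : (const a) @ z = quat_map toC a.
    by apply: quatP; rewrite /= /ceval map_polyC hornerC.
  move: xy; rewrite yE qconjM [qconj (w * _ + _)]qconjD qconjM qconjK.
  rewrite !rmorphM rmorphD rmorphM /= !quat_map_conj.
  move=> /(congr1 ( *%R^~ ((const a) @ z))); rewrite mul0r.
  rewrite mulrDr [qconj _ * _]mulrA.
  have nz' : qconj ((qlin k) @ z) * ((qlin k) @ z) = 0.
    by rewrite mul_conjq qnorm_map /= nk rmorph0.
  rewrite nz' mul0r add0r -!mulrA mul_conjq caz qnorm_map => xa.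
  by rewrite qscalarC -mulrA.
(* Multiplying [x * qconj (t - k) = N(t - k) * w'] by [t - k] on the right and cancelling the norm
   gives [x = w' * (t - k)]. *)
have [w' xw] := dvd_qscalar_ceval z0 nk xk.
exists k, w', (w * qconj (qlin k) + const a); split=> //.
have n0 : qnorm (qlin k) != 0 by rewrite -size_poly_eq0 size_qnorm_qlin.
apply: (qscalar_mulI n0).
by rewrite qscalarC -{1}mul_conjq mulrA xw mulrA.
Qed.

End RightFactor.

(** * Splitting a pencil into linear factors *)

Section Factorization.
Variable R : realType.
Local Notation toC := (real_complex R).
Local Notation "x @ z" := (quat_map (ceval z) x) (at level 10).
Local Notation const := (quat_map (@polyC R)).
Implicit Types (x y : quat {poly R}) (z : R[i]) (k : quat R).

Definition qprod (hs : seq (quat R)) : quat {poly R} :=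
  quat_of_poly (prod_t hs).

Lemma quat_of_poly_XsubC k : quat_of_poly ('X - k%:P) = qlin k.
Proof. by rewrite rmorphB /= quat_of_polyX quat_of_polyC. Qed.

Lemma qprod_nil : qprod [::] = 1.
Proof. by rewrite /qprod /prod_t big_nil rmorph1. Qed.

Lemma qprod_cons k ks : qprod (k :: ks) = qlin k * qprod ks.
Proof. by rewrite /qprod /prod_t big_cons rmorphM /= quat_of_poly_XsubC. Qed.

Lemma qprod_rcons ks k : qprod (rcons ks k) = qprod ks * qlin k.
Proof.
rewrite /qprod /prod_t -cats1 big_cat big_seq1 rmorphM /=.
by rewrite quat_of_poly_XsubC.
Qed.

Lemma qconj_qlin k : qconj (qlin k) = qlin (qconj k).
Proof. by apply: quatP; rewrite /qlin /= ?polyCN; ring. Qed.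

Lemma qconj_qprod ks : qconj (qprod ks) = qprod (rev (map (@qconj R) ks)).
Proof.
elim: ks => [|k ks IH]; first by rewrite qprod_nil; apply: quatP => /=; ring.
by rewrite qprod_cons qconjM IH rev_cons qprod_rcons qconj_qlin.
Qed.

Lemma qnorm_ceval0 z x : x @ z = 0 -> ceval z (qnorm x) = 0.
Proof. by rewrite -qnorm_map => ->; rewrite /qnorm /= expr0n /= !addr0. Qed.

(** A real [z] would be a zero of both. Otherwise the one of [x], [y] that survives at [z] supplies
    the linear factor, the hypotheses being symmetric under conjugation of the product. *)
Lemma common_factor z x y : ceval z (qnorm x) = 0 -> ceval z (qnorm y) = 0 ->
  ~ (x @ z = 0 /\ y @ z = 0) -> (x * qconj y) @ z = 0 ->
  exists k x' y', x = x' * qlin k /\ y = y' * qlin k.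
Proof.
move=> nx ny nxy xy.
have z0 : complex.Im z != 0.
  by apply/eqP => z0; apply: nxy; split; exact: ceval_real_null.
have [y0|/eqP yz] := eqVneq (y @ z) 0.
  2: exact: common_right_factor z0 ny yz xy.
have xz : x @ z <> 0 by move=> x0; apply: nxy.
have yx : (y * qconj x) @ z = 0.
  by rewrite -[y * _]qconjK qconjM qconjK quat_map_conj xy raddf0.
have [k [y' [x' [yE xE]]]] := common_right_factor z0 nx xz yx.
by exists k, x', y'.
Qed.

(* Right factors are split off before left ones, so that in the end
   [x * qconj y] is the norm of the right factors times a quaternionic
   polynomial without complex zeros. *)
Lemma pencil_factorization (r0 r1 : R) x y :
  r0 != 0 -> qnorm x != 0 -> qnorm y = r0%:P * qnorm x ->
  qre (x * qconj y) = r1%:P * qnorm x ->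
  (forall z, ~ (x @ z = 0 /\ y @ z = 0)) ->
  exists hs ks c h, [/\ x = qprod hs * const c * qprod ks,
    y = qprod hs * const h * qprod ks &
    forall z,
      ((qprod hs * const c) * qconj (qprod hs * const h)) @ z <> 0].
Proof.
move=> r00; have [n] := ubnP (size (qnorm x)).
elim: n x y => // n IH x y sx nx ny xy nz.
have ny_root z : ceval z (qnorm x) = 0 -> ceval z (qnorm y) = 0.
  by move=> h; rewrite ny rmorphM /= h mulr0.
have nL k : qnorm (qlin k) != 0 by rewrite -size_poly_eq0 size_qnorm_qlin.
(* Removing a common linear factor divides both norms and the inner product by the same [N(t - k)],
   so the ratios [r0], [r1] persist while the degree of the norm drops. *)
have descent k x' y' :
    qnorm x = qnorm (qlin k) * qnorm x' -> qnorm y = qnorm (qlin k) * qnorm y' ->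
    qre (x * qconj y) = qnorm (qlin k) * qre (x' * qconj y') ->
    (forall z, ~ (x' @ z = 0 /\ y' @ z = 0)) ->
    exists hs ks c h, [/\ x' = qprod hs * const c * qprod ks,
      y' = qprod hs * const h * qprod ks &
      forall z, ((qprod hs * const c) * qconj (qprod hs * const h)) @ z <> 0].
  move=> ex ey exy nz'.
  have nx' : qnorm x' != 0 by apply: contraNneq nx => h; rewrite ex h mulr0.
  apply: IH => //.
  - move: sx; rewrite ex size_mul // size_qnorm_qlin !addSn add0n ltnS.
    by move/ltnW.
  - by apply: (mulfI (nL k)); rewrite -ey ny ex mulrCA.
  - by apply: (mulfI (nL k)); rewrite -exy xy ex mulrCA.
(* As long as [x * qconj y] has a complex zero, a common right factor splits off. *)
have [[z xyz]|xy_nz] := pselect (exists z, (x * qconj y) @ z = 0).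
  have nxz : ceval z (qnorm x) = 0.
    have := qnorm_ceval0 xyz; rewrite qnormM qnorm_conj ny rmorphM /= rmorphM /=.
    rewrite cevalC => /eqP; rewrite !mulf_eq0 fmorph_eq0 (negbTE r00) /=.
    by rewrite orbb => /eqP.
  have [k [x' [y' [xE yE]]]] := common_factor nxz (ny_root _ nxz) (@nz z) xyz.
  have [||||hs [ks [c [h [x'E y'E nz']]]]] := descent k x' y'.
  - by rewrite xE qnormM mulrC.
  - by rewrite yE qnormM mulrC.
  - by rewrite xE yE inner_mulr.
  - move=> w [xw yw]; apply: (nz w).
    by rewrite xE yE !rmorphM /= xw yw !mul0r.
  exists hs, (rcons ks k), c, h; split=> //.
    by rewrite qprod_rcons xE x'E -!mulrA.
  by rewrite qprod_rcons yE y'E -!mulrA.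
(* Now [x * qconj y] has no complex zero, so at a zero of the norm [null_pencil] leaves
   [qconj y * x = 0]: the conjugates share a right factor, hence [x] and [y] a left one. *)
have [[z nxz]|nx_root] := pselect (exists z, ceval z (qnorm x) = 0).
  have yxz : (qconj y * x) @ z = 0.
    have [] // := @null_pencil R[i] (x @ z) (y @ z).
    - by rewrite qnorm_map.
    - by rewrite qnorm_map /= ny_root.
    - rewrite -quat_map_conj -rmorphM -[LHS]/(ceval z (qre (x * qconj y))).
      by rewrite xy rmorphM /= nxz mulr0.
    - rewrite -quat_map_conj -rmorphM => h; case: xy_nz; exists z; exact: h.
    - by rewrite -quat_map_conj -rmorphM.
  have [||||k [x' [y' [xE yE]]]] := @common_factor z (qconj x) (qconj y).
  - by rewrite qnorm_conj.
  - by rewrite qnorm_conj ny_root.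
  - move=> [xz yz]; apply: (nz z); split.
      by rewrite -[x]qconjK quat_map_conj xz raddf0.
    by rewrite -[y]qconjK quat_map_conj yz raddf0.
  - rewrite -[_ * _]qconjK qconjM !qconjK quat_map_conj.
    by rewrite yxz raddf0.
  have {}xE : x = qlin (qconj k) * qconj x'.
    by rewrite -qconj_qlin -qconjM -xE qconjK.
  have {}yE : y = qlin (qconj k) * qconj y'.
    by rewrite -qconj_qlin -qconjM -yE qconjK.
  have [||||hs [ks [c [h [x'E y'E nz']]]]] :=
    descent (qconj k) (qconj x') (qconj y').
  - by rewrite xE qnormM.
  - by rewrite yE qnormM.
  - by rewrite xE yE inner_mull.
  - move=> w [xw yw]; apply: (nz w).
    by rewrite xE yE !rmorphM /= xw yw !mulr0.
  exists (qconj k :: hs), ks, c, h; split.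
  - by rewrite qprod_cons xE x'E -!mulrA.
  - by rewrite qprod_cons yE y'E -!mulrA.
  move=> w hw; apply: xy_nz; exists w.
  (* Multiplication by the norm of the right factors restores [x * qconj y], whose zeros are already
     excluded. *)
  have -> : x * qconj y = qscalar (qnorm (qprod ks)) *
    ((qprod (qconj k :: hs) * const c) * qconj (qprod (qconj k :: hs) * const h)).
    rewrite xE yE x'E y'E qprod_cons.
    set l := qlin _; set F := qprod hs; set G := qprod ks.
    have -> : l * (F * const c * G) = (l * F * const c) * G by rewrite !mulrA.
    have -> : l * (F * const h * G) = (l * F * const h) * G by rewrite !mulrA.
    exact: mulq_conj_mulr.
  by rewrite rmorphM [X in _ * X]hw mulr0.
(* A norm without complex roots is constant, and so are [x] and [y]. *)
have sx1 : size (qnorm x) = 1%N.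
  apply/eqP; rewrite -(size_map_poly toC).
  by apply/closed_rootP => -[z /rootP hz]; apply: nx_root; exists z.
have [c xc] : exists c, x = const c by apply: qnorm_size_le1; rewrite sx1.
have [h yh] : exists h, y = const h.
  by apply: qnorm_size_le1; rewrite ny mul_polyC size_scale // sx1.
exists [::], [::], c, h; rewrite !qprod_nil !mul1r !mulr1 -xc -yh; split=> //.
by move=> z hz; apply: xy_nz; exists z.
Qed.

End Factorization.

(** * Factorizations of [Q] in terms of [Q0] and [Q1] *)

Lemma card_ge2P (T : Type) (A : set (set T)) :
  (`I_2 #<= A)%card <-> exists a b, [/\ A a, A b & a <> b].
Proof.
split=> [/pcard_leP[f]|[a [b [Aa Ab ab]]]].
  exists (f 0%N), (f 1%N); split; [exact: funS|exact: funS|].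
  by move=> /(@inj _ _ _ f); rewrite !inE => /(_ isT isT).
apply/pcard_leP/injfunPex; exists (fun n => if n is 0%N then a else b).
  by case.
by move=> [|[|n]] [|[|m]]; rewrite !inE //= => _ _ e; case: ab.
Qed.

Lemma pencil_coef (A : nzRingType) (a b : A) i :
  (a%:P + 'X * b%:P)`_i = if i is j.+1 then (if j == 0%N then b else 0) else a.
Proof.
by rewrite coefD coefC coefXM; case: i => [|i] /=; rewrite ?addr0 ?add0r // coefC.
Qed.

Lemma pred2_addn a b : (0 < a -> 0 < b -> (a + b).-2 = a.-1 + b.-1)%N.
Proof. by case: a b => [|a] [|b] // _ _; rewrite addSn addnS. Qed.

(** Degree count with sizes: [a], [b] stand for the norms of the right and left factors, [A], [B]
    for the contents that they divide, [p] for [deg P]. *)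
Lemma pred_addn_squeeze a b A B p :
  (0 < a -> 0 < b -> a <= A -> b <= B -> A.-1 + B.-1 <= p ->
   p = b.-1 + a.-1 -> b = B)%N.
Proof. by lia. Qed.

Section Fact.
Variable R : realType.
Implicit Types (H G : {poly quat R}) (Q : {poly {poly quat R}}).
Implicit Types (f : factorization R).

Local Notation qpoly := (@quat_of_poly R).

Lemma qpoly_inj : injective qpoly.
Proof. exact: can_inj (@quat_of_polyK R). Qed.

Lemma qpoly_eq0 H : (qpoly H == 0) = (H == 0).
Proof. by rewrite -(rmorph0 qpoly) (inj_eq qpoly_inj). Qed.

Lemma pconj_is_additive : zmod_morphism (@pconj R).
Proof. by move=> H G; rewrite /pconj raddfB. Qed.
HB.instance Definition _ := GRing.isZmodMorphism.Build
  {poly quat R} {poly quat R} (@pconj R) pconj_is_additive.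

(** Comparison of the coefficients of [s^2], [1] and [s]; the last one is a quaternion plus its
    conjugate, hence twice a real part. *)
Lemma pencil_norm (Q0 Q1 : {poly quat R}) (P S : {poly R}) :
  let Q := Q0%:P + 'X * Q1%:P in
  Q * pconj2 Q = real_t P * real_s S ->
  [/\ qnorm (qpoly Q1) = S`_2 *: P, qnorm (qpoly Q0) = S`_0 *: P &
      qre (qpoly Q1 * qconj (qpoly Q0)) *+ 2 = S`_1 *: P].
Proof.
move=> Q /polyP QS.
have cQ i : (pconj2 Q)`_i = pconj Q`_i by rewrite coef_map.
have cS i : qpoly ((real_t P * real_s S)`_i) = qscalar (S`_i *: P).
  have sS : (real_s S)`_i = (qscalar S`_i)%:P.
    by rewrite coef_map_id0 // !raddf0.
  rewrite coefCM sS rmorphM /= quat_of_poly_scalar quat_of_polyC.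
  by rewrite quat_map_scalar /= -rmorphM mulrC mul_polyC.
have {}QS i := etrans (congr1 qpoly (QS i)) (cS i).
split.
- have := QS 2%N; rewrite coefM !big_ord_recl big_ord0 !cQ !pencil_coef /=.
  rewrite raddf0 mulr0 mul0r !addr0 add0r rmorphM /= quat_of_pconj mulq_conj.
  by case.
- have := QS 0%N; rewrite coefM !big_ord_recl big_ord0 !cQ !pencil_coef /=.
  by rewrite !addr0 rmorphM /= quat_of_pconj mulq_conj; case.
- have := QS 1%N; rewrite coefM !big_ord_recl big_ord0 !cQ !pencil_coef /=.
  rewrite !addr0 rmorphD !rmorphM /= !quat_of_pconj.
  rewrite -[qpoly Q0 * _]qconjK qconjM qconjK addrC addq_conj.
  by case.
Qed.

Lemma divides_coords_content (Q0 Q1 : {poly quat R}) (d : {poly R}) :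
  d %| content (qpoly Q0) -> d %| content (qpoly Q1) ->
  divides_coords d%:P (Q0%:P + 'X * Q1%:P).
Proof.
move=> /dvdp_content[y yE] /dvdp_content[x xE].
have coordE (g : {additive quat R -> R}) :
    coord2 g (Q0%:P + 'X * Q1%:P) =
      (map_poly g Q0)%:P + 'X * (map_poly g Q1)%:P.
  apply/polyP => i; rewrite /coord2 coef_map !pencil_coef.
  by case: i => [|[|i]] //=; rewrite raddf0.
have divE (g : {additive quat R -> R}) a b :
    map_poly g Q0 = d * a -> map_poly g Q1 = d * b ->
    divides d%:P (coord2 g (Q0%:P + 'X * Q1%:P)).
  move=> ga gb; exists (a%:P + 'X * b%:P); rewrite coordE ga gb.
  by rewrite mulrDl -mulrA -!polyCM ![_ * d]mulrC.
move: xE yE; rewrite !qscalar_mulE => -[x1 x2 x3 x4] [y1 y2 y3 y4].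
by split; [exact: divE y1 x1|exact: divE y2 x2|exact: divE y3 x3|
           exact: divE y4 x4].
Qed.

(** A common zero is a root of the gcd [d] of the two contents. This [d] divides all coordinates of
    [Q], hence 1, and evaluation at [z] gives [0 = 1]. *)
Lemma gcd1_no_common_zero (Q0 Q1 : {poly quat R}) z :
  is_gcd (Q0%:P + 'X * Q1%:P) 1 ->
  ~ (quat_map (ceval z) (qpoly Q1) = 0 /\ quat_map (ceval z) (qpoly Q0) = 0).
Proof.
move=> [_ _ g1] [/ceval_eq0P x0 /ceval_eq0P y0].
pose d := gcdp (content (qpoly Q0)) (content (qpoly Q1)).
have /g1[c /(congr1 (fun p : {poly {poly R}} => ceval z p`_0))] :
    divides_coords d%:P (Q0%:P + 'X * Q1%:P).
  by apply: divides_coords_content; rewrite ?dvdp_gcdl ?dvdp_gcdr.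
have dz : ceval z d = 0.
  by apply/eqP; rewrite -[_ == 0]/(root _ z) gcdp_map root_gcd y0.
by rewrite coefMC coef1 rmorphM /= dz mulr0 rmorph1 => /eqP; rewrite oner_eq0.
Qed.

(** Otherwise [s] would divide all coordinates of [Q]. *)
Lemma gcd1_neq0 (Q0 Q1 : {poly quat R}) :
  is_gcd (Q0%:P + 'X * Q1%:P) 1 -> Q0 != 0.
Proof.
move=> [_ _ g1]; apply/eqP => Q00.
have /g1[c /(congr1 (fun p : {poly {poly R}} => p`_0))] :
    divides_coords 'X (Q0%:P + 'X * Q1%:P).
  have divE (g : {additive quat R -> R}) :
      divides 'X (coord2 g (Q0%:P + 'X * Q1%:P)).
    exists (map_poly g Q1)%:P; apply/polyP => i.
    rewrite /coord2 Q00 coefMX coefC coef_map pencil_coef.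
    by case: i => [|[|i]] //=; rewrite raddf0.
  by split; exact: divE.
by rewrite coef1 coefMX => /eqP; rewrite oner_eq0.
Qed.

Lemma factorization_prodE f :
  factorization_prod f =
  (- (prod_t (left_t f) * (mid_s f)%:P * prod_t (right_t f)))%:P
  + 'X * (prod_t (left_t f) * prod_t (right_t f))%:P.
Proof.
rewrite /factorization_prod mulrBr mulrBl -!polyCM addrC polyCN.
congr (_ + _).
by rewrite commr_polyX -mulrA -polyCM.
Qed.

Lemma pencil_inj (Q0 Q1 H G : {poly quat R}) :
  Q0%:P + 'X * Q1%:P = H%:P + 'X * G%:P -> Q0 = H /\ Q1 = G.
Proof.
move=> /polyP e; have := e 0%N; have := e 1%N.
by rewrite !pencil_coef.
Qed.

Lemma monic_prod_t (hs : seq (quat R)) : prod_t hs \is monic.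
Proof. exact: monic_prod_XsubC. Qed.

(** Equivalence of factorizations thus becomes equality of the real polynomials [N(F)]. *)
Lemma quat_of_left_norm f :
  qpoly (left_norm f) = qscalar (qnorm (qprod (left_t f))).
Proof.
rewrite /left_norm; elim: (left_t f) => [|h hs IH].
  by rewrite big_nil qprod_nil qnorm1 !rmorph1.
rewrite big_cons 2!rmorphM /= IH quat_of_pconj quat_of_poly_XsubC mulq_conj.
by rewrite -rmorphM -qnormM qprod_cons.
Qed.

Lemma monic_qnorm_qprod (hs : seq (quat R)) : qnorm (qprod hs) \is monic.
Proof.
elim: hs => [|h hs IH]; first by rewrite qprod_nil qnorm1 monic1.
rewrite qprod_cons qnormM monicMr // qnorm_qlin -addrA -mulNr -polyCN.
by rewrite monicE lead_coefDl ?lead_coefXn // size_polyXn ltnS size_affine.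
Qed.

Lemma qnorm_qprod_conj (hs : seq (quat R)) :
  qnorm (qprod (rev (map (@qconj R) hs))) = qnorm (qprod hs).
Proof. by rewrite -qconj_qprod qnorm_conj. Qed.

Lemma quat_of_poly_prod hs (c : quat R) ks :
  qpoly (prod_t hs * c%:P * prod_t ks) =
  qprod hs * quat_map (@polyC R) c * qprod ks.
Proof. by rewrite -quat_of_polyC /qprod -rmorphM -rmorphM. Qed.

(** Products of linear factors are monic, so monicity of [Q1] forces [c = 1]. The sign of [h] is due
    to the middle factor being [s - mid_s]. *)
Lemma fact_of_qprod (Q0 Q1 : {poly quat R}) hs ks (c h : quat R) :
  Q1 \is monic ->
  qpoly Q1 = qprod hs * quat_map (@polyC R) c * qprod ks ->
  qpoly Q0 = qprod hs * quat_map (@polyC R) h * qprod ks ->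
  fact (Q0%:P + 'X * Q1%:P) (Factorization hs (- h) ks).
Proof.
rewrite -!quat_of_poly_prod => Q1m /qpoly_inj Q1E /qpoly_inj Q0E.
have c1 : c = 1.
  move: Q1m; rewrite monicE Q1E lead_coef_Mmonic ?monic_prod_t //.
  by rewrite lead_coef_monicM ?monic_prod_t // lead_coefC => /eqP.
have Q1E' : Q1 = prod_t hs * prod_t ks by rewrite Q1E c1 polyC1 mulr1.
rewrite /fact /mkset factorization_prodE.
rewrite [left_t _]/= [right_t _]/= [mid_s _]/= Q1E' Q0E.
by rewrite (polyCN h) mulrN mulNr opprK.
Qed.

Lemma factP (Q0 Q1 : {poly quat R}) f :
  fact (Q0%:P + 'X * Q1%:P) f ->
  Q1 = prod_t (left_t f) * prod_t (right_t f) /\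
  Q0 = - (prod_t (left_t f) * (mid_s f)%:P * prod_t (right_t f)).
Proof. by rewrite /fact /= factorization_prodE => /pencil_inj[]. Qed.

(* [Q1 Q0* = - N(G) F h* F*] and [Q0* Q1 = - N(F) G* h* G], where [F] and [G]
   are the products of the left and right factors. *)
Lemma fact_dvdp (Q0 Q1 : {poly quat R}) f :
  fact (Q0%:P + 'X * Q1%:P) f ->
  qnorm (qprod (right_t f)) %| content (qpoly (Q1 * pconj Q0)) /\
  qnorm (qprod (left_t f)) %| content (qpoly (pconj Q0 * Q1)).
Proof.
move=> /factP[Q1E Q0E].
have -> : qpoly (Q1 * pconj Q0) = qpoly Q1 * qconj (qpoly Q0).
  by rewrite rmorphM -quat_of_pconj.
have -> : qpoly (pconj Q0 * Q1) = qconj (qpoly Q0) * qpoly Q1.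
  by rewrite rmorphM -quat_of_pconj.
have -> : qpoly Q0 = - (qprod (left_t f) * quat_map (@polyC R) (mid_s f)
                        * qprod (right_t f)).
  by rewrite Q0E rmorphN -quat_of_poly_prod.
have -> : qpoly Q1 = qprod (left_t f) * qprod (right_t f).
  by rewrite Q1E rmorphM.
set F := qprod (left_t f); set G := qprod (right_t f); set u := quat_map _ _.
have cE : qconj (- (F * u * G)) = - (qconj G * qconj u * qconj F).
  by rewrite raddfN /= !qconjM mulrA.
split.
  have -> : F * G * qconj (- (F * u * G)) =
      qscalar (qnorm G) * - (F * qconj u * qconj F).
    by rewrite cE !mulrN !mulrA -[F * G * _]mulrA mulq_conj -qscalarC.
  by rewrite (eqp_dvdr _ (content_scalarM _ _)) dvdp_mulIl.
have -> : qconj (- (F * u * G)) * (F * G) =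
    qscalar (qnorm F) * - (qconj G * qconj u * G).
  rewrite cE mulrN mulNr !mulrA -[_ * qconj F * F]mulrA mul_conjq -qscalarC.
  by rewrite !mulrA.
by rewrite (eqp_dvdr _ (content_scalarM _ _)) dvdp_mulIl.
Qed.

End Fact.

(** * The number of classes against the degree of [P] *)

Theorem theorem7p3 (R : realType) (Q0 Q1 : {poly quat R})
    (Q : {poly {poly quat R}}) (P S : {poly R})
    (defQ : Q = Q0%:P + 'X * Q1%:P)
    (Q1_monic : Q1 \is monic)
    (gcdQ : is_gcd Q 1)
    (normQ : Q * pconj2 Q = real_t P * real_s S) :
  (`I_2 #<= Fact Q)%card
  <->
  ((size P).-1 < card_zeros (Q1 * pconj Q0) + card_zeros (pconj Q0 * Q1))%N.
Proof.
rewrite defQ in gcdQ normQ *; clear defQ Q.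
set x := quat_of_poly Q1; set y := quat_of_poly Q0.
have [nx ny xy] := pencil_norm normQ.
have nz z := gcd1_no_common_zero (z := z) gcdQ.
have x0 : x != 0 by rewrite qpoly_eq0 monic_neq0.
have y0 : y != 0 by rewrite qpoly_eq0 (gcd1_neq0 gcdQ).
have nx0 : qnorm x != 0 by rewrite qnorm_poly_eq0; exact: x0.
have ny0 : qnorm y != 0 by rewrite qnorm_poly_eq0; exact: y0.
have S2 : S`_2 != 0 by apply: contraNneq nx0 => e; rewrite nx e scale0r.
have S0 : S`_0 != 0 by apply: contraNneq ny0 => e; rewrite ny e scale0r.
have PE : P = (S`_2)^-1 *: qnorm x by rewrite nx scalerA mulVf // scale1r.
have sP : size P = size (qnorm x) by rewrite nx size_scale.
have xyE : quat_of_poly (Q1 * pconj Q0) = x * qconj y.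
  by rewrite rmorphM /= quat_of_pconj.
have yxE : quat_of_poly (pconj Q0 * Q1) = qconj y * x.
  by rewrite rmorphM /= quat_of_pconj.
have QA0 : Q1 * pconj Q0 != 0.
  by rewrite -qpoly_eq0 xyE -qnorm_poly_eq0 qnormM qnorm_conj mulf_neq0.
have QB0 : pconj Q0 * Q1 != 0.
  by rewrite -qpoly_eq0 yxE -qnorm_poly_eq0 qnormM qnorm_conj mulf_neq0.
rewrite !card_zerosE // xyE yxE card_ge2P.
set gA := content _; set gB := content _.
have gA0 : gA != 0 by rewrite content_eq0 -xyE qpoly_eq0.
have gB0 : gB != 0 by rewrite content_eq0 -yxE qpoly_eq0.
(* [Q1 = F G], so up to a constant [P] is [N(F) N(G)] and the degrees add up. *)
have sFG f : fact (Q0%:P + 'X * Q1%:P) f ->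
    (size P).-1 = ((size (qnorm (qprod (left_t f)))).-1
                   + (size (qnorm (qprod (right_t f)))).-1)%N.
  move=> /factP[Q1E _].
  rewrite sP /x Q1E rmorphM /= qnormM -![quat_of_poly (prod_t _)]/(qprod _).
  have Fm := monic_qnorm_qprod (left_t f).
  have Gm := monic_qnorm_qprod (right_t f).
  by rewrite size_mul ?monic_neq0 // pred2_addn // size_poly_gt0 monic_neq0.
split=> [[_ [_ [[f Qf <-] [g Qg <-] fg]]]|ltP].
  rewrite ltnNge; apply/negP => leP; apply: fg.
  (* [N(F)] and [N(G)] divide [gB] and [gA]. Under [leP] their degrees leave no slack, so [N(F)] is
     [gB] up to a constant for every factorization. *)
  have nF e : fact (Q0%:P + 'X * Q1%:P) e -> qnorm (qprod (left_t e)) %= gB.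
    move=> Qe; have [] := fact_dvdp Qe; rewrite xyE yxE => dA dB.
    rewrite -dvdp_size_eqp //; apply/eqP.
    apply: (pred_addn_squeeze _ _ (dvdp_leq gA0 dA) (dvdp_leq gB0 dB) leP).
    - by rewrite size_poly_gt0 monic_neq0 // monic_qnorm_qprod.
    - by rewrite size_poly_gt0 monic_neq0 // monic_qnorm_qprod.
    - exact: sFG.
  suff fgE : left_norm f = left_norm g by rewrite /fact_class fgE.
  apply: (@qpoly_inj R); rewrite !quat_of_left_norm; congr qscalar.
  apply/eqP; rewrite -eqp_monic ?monic_qnorm_qprod //.
  by rewrite (eqp_trans (nF f Qf)) // eqp_sym nF.
(* Elimination of [P] from the three coefficient equations; the 2 comes from the twofold real
   part. *)
pose r0 := S`_0 / S`_2; pose r1 := S`_1 / S`_2 / 2.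
have r00 : r0 != 0 by rewrite mulf_neq0 ?invr_eq0.
have nyx : qnorm y = r0%:P * qnorm x.
  by rewrite ny PE mul_polyC scalerA.
have ixy : qre (x * qconj y) = r1%:P * qnorm x.
  have two0 : (2 : R) != 0 by rewrite pnatr_eq0.
  apply: (scalerI two0); rewrite scaler_nat xy PE mul_polyC !scalerA.
  by congr (_ *: _); rewrite /r1; field; rewrite ?S2.
have [hs [ks [c [h [xE yE cz]]]]] :=
  pencil_factorization r00 nx0 nyx ixy nz.
(* Splitting the conjugates and conjugating back exchanges and reverses the two lists, so that left
   factors are now split off first. *)
have [||||hs' [ks' [c' [h' [xE' yE' cz']]]]] :=
    @pencil_factorization R r0 r1 (qconj x) (qconj y) r00.
- by rewrite qnorm_conj.
- by rewrite !qnorm_conj.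
- by rewrite inner_conj qnorm_conj.
- move=> z [xz yz]; apply: (nz z); rewrite -/x -/y.
  split; first by rewrite -[x]qconjK quat_map_conj xz raddf0.
  by rewrite -[y]qconjK quat_map_conj yz raddf0.
have Qf := fact_of_qprod Q1_monic xE yE.
have xE'' : x = qprod (rev (map (@qconj R) ks')) *
    quat_map (@polyC R) (qconj c') * qprod (rev (map (@qconj R) hs')).
  by rewrite -!qconj_qprod quat_map_conj -!qconjM mulrA -xE' qconjK.
have yE'' : y = qprod (rev (map (@qconj R) ks')) *
    quat_map (@polyC R) (qconj h') * qprod (rev (map (@qconj R) hs')).
  by rewrite -!qconj_qprod quat_map_conj -!qconjM mulrA -yE' qconjK.
have Qg := fact_of_qprod Q1_monic xE'' yE''.
set f := Factorization _ _ _ in Qf; set g := Factorization _ _ _ in Qg.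
(* [x * qconj y] is [N(G)] times a factor without complex zeros, so its content has the degree of
   [N(G)]. *)
have sA : size (qnorm (qprod (right_t f))) = size gA.
  rewrite -(size_content_scalarM _ cz) /gA xE yE; congr (size (content _)).
  by rewrite mulq_conj_mulr.
have sB : size (qnorm (qprod (left_t g))) = size gB.
  have yxg : qconj (qconj x * qconj (qconj y)) = qconj y * x.
    by rewrite qconjM !qconjK.
  have nz' z : quat_map (ceval z) (qconj (qprod hs' * quat_map (@polyC R) c' *
      qconj (qprod hs' * quat_map (@polyC R) h'))) <> 0.
    rewrite quat_map_conj => /(congr1 (@qconj _)).
    by rewrite qconjK raddf0; exact: cz'.
  rewrite /= qnorm_qprod_conj -(size_content_scalarM _ nz') /gB.
  rewrite -yxg yE' xE'; congr (size (content _)).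
  by rewrite mulq_conj_mulr [RHS]qconjM qconj_scalar -qscalarC.
exists (fact_class (Q0%:P + 'X * Q1%:P) f), (fact_class (Q0%:P + 'X * Q1%:P) g).
split; [by exists f|by exists g|].
move=> /seteqP[/(_ f)[] //= _ fg _].
have {}fg : qnorm (qprod (left_t f)) = qnorm (qprod (left_t g)).
  have := congr1 (@quat_of_poly R) fg; rewrite !quat_of_left_norm.
  by case.
(* Equal left norms would give [deg P = #A + #B]. *)
by move: ltP; rewrite (sFG f Qf) fg sA sB addnC ltnn.
Qed.
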